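(* The following is a complete set of representatives for the isomorphism classes of PostLie algebras $(\mathrm{sl}(2,\mathbb{C}),[,],\circ)$ on the Lie algebra $(\mathrm{sl}(2,\mathbb{C}),[,])$ (that is, every PostLie algebra structure on $(\mathrm{sl}(2,\mathbb{C}),[,])$ is isomorphic, on this Lie algebra, to exactly one member of the list, where different values of the parameter $k$ in item (5) count as different members). In each item the operation $\circ$ is the bilinear operation determined by the given values on the basis $e_1,e_2,e_3$: (1) $e_i\circ e_j=0$, $i,j=1,2,3$; (2) $e_i\circ e_j=[-e_i,e_j]$, $i,j=1,2,3$; (3) $e_1\circ e_i=[-e_1,e_i]$, $\ e_2\circ e_i=[-\frac{1+\sqrt{-1}}{2}e_2+\frac{\sqrt{-1}-1}{2}e_3,\,e_i]$, $\ e_3\circ e_i=[-\frac{1+\sqrt{-1}}{2}e_2+\frac{\sqrt{-1}-1}{2}e_3,\,e_i]$, $\ i=1,2,3$; (4) $e_1\circ e_i=[(\sqrt{-1}-\frac12)e_1+(1-\frac{\sqrt{-1}}{2})e_2,\,e_i]$, $\ e_2\circ e_i=[(1+\frac{\sqrt{-1}}{2})e_1-(\sqrt{-1}+\frac12)e_2,\,e_i]$, $\ e_3\circ e_i=0$, $\ i=1,2,3$; (5) $e_1\circ e_i=[k e_1,e_i]$, $\ e_2\circ e_i=[-\frac12 e_2+\frac{\sqrt{-1}}{2}e_3,\,e_i]$, $\ e_3\circ e_i=[-\frac{\sqrt{-1}}{2}e_2-\frac12 e_3,\,e_i]$, $\ i=1,2,3$, where $k\in\mathbb{C}$.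
   Context: Basis: $e_1=\frac12\begin{pmatrix}0&1\\-1&0\end{pmatrix}$, $e_2=\frac{1}{2\sqrt{-1}}\begin{pmatrix}0&1\\1&0\end{pmatrix}$, $e_3=\frac{1}{2\sqrt{-1}}\begin{pmatrix}1&0\\0&-1\end{pmatrix}$ is a $\mathbb{C}$-basis of $\mathrm{sl}(2,\mathbb{C})$, and with the commutator bracket $[,]$ one has $[e_2,e_3]=e_1$, $[e_3,e_1]=e_2$, $[e_1,e_2]=e_3$. A (left) PostLie $\mathbb{C}$-algebra is a $\mathbb{C}$-vector space $L$ with two bilinear operations $\circ$ and $[,]$ such that for all $x,y,z\in L$: $[x,y]=-[y,x]$; $[[x,y],z]+[[z,x],y]+[[y,z],x]=0$; $z\circ(y\circ x)-y\circ(z\circ x)+(y\circ z)\circ x-(z\circ y)\circ x+[y,z]\circ x=0$; and $z\circ[x,y]-[z\circ x,y]-[x,z\circ y]=0$. By the first two relations $(L,[,])$ is a Lie algebra, and $(L,[,],\circ)$ is called a PostLie algebra on the Lie algebra $(L,[,])$. Two PostLie algebras $(\mathfrak{g},[,],\circ)$ and $(\mathfrak{g},[,],\star)$ on the same Lie algebra $(\mathfrak{g},[,])$ are called isomorphic on the Lie algebra $(\mathfrak{g},[,])$ if there is an automorphism $f$ of the Lie algebra $(\mathfrak{g},[,])$ such that $f(x\circ y)=f(x)\star f(y)$ for all $x,y\in\mathfrak{g}$. *)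

(* Defs.v *)
From HB Require Import structures.
From mathcomp Require Import all_boot all_order all_algebra.
From mathcomp Require Import ring.
From mathcomp Require Export complex reals.

Set Implicit Arguments.
Unset Strict Implicit.
Unset Printing Implicit Defensive.

Import Order.TTheory GRing.Theory Num.Theory.
Local Open Scope ring_scope.

Section PostLie.
Variables (K : fieldType) (L : lmodType K).
Implicit Types (br circ star : L -> L -> L) (f : L -> L).

Definition bilinear_op (op : L -> L -> L) : Prop :=
  (forall x, linear (op x)) /\ (forall y, linear (op ^~ y)).

Record is_postlie br circ : Prop := IsPostLie {
  postlie_br_bilinear : bilinear_op br;
  postlie_circ_bilinear : bilinear_op circ;
  postlie_antisym : forall x y, br x y = - br y x;
  postlie_jacobi : forall x y z,
    br (br x y) z + br (br z x) y + br (br y z) x = 0;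
  postlie_assoc : forall x y z,
    circ z (circ y x) - circ y (circ z x)
      + circ (circ y z) x - circ (circ z y) x + circ (br y z) x = 0;
  postlie_der : forall x y z,
    circ z (br x y) - br (circ z x) y - br x (circ z y) = 0
}.

Definition lie_automorphism br f : Prop :=
  [/\ linear f, bijective f & forall x y, f (br x y) = br (f x) (f y)].

Definition postlie_isomorphic br circ star : Prop :=
  exists f, lie_automorphism br f
            /\ forall x y, f (circ x y) = star (f x) (f y).

End PostLie.

Section SL2.
Variable K : fieldType.

Definition sl2_vspace : {vspace 'M[K]_2} :=
  lker (linfun (@mxtrace K 2 : 'M[K]_2 -> K^o)).

Lemma mem_sl2 (A : 'M[K]_2) : (A \in sl2_vspace) = (\tr A == 0).
Proof. by rewrite memv_ker lfunE. Qed.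

Definition sl2 := subvs_of sl2_vspace.

Fact comm_sl2_subproof (A B : 'M[K]_2) : A *m B - B *m A \in sl2_vspace.
Proof. by rewrite mem_sl2 linearB /= mxtrace_mulC subrr. Qed.

Definition sl2_br (x y : sl2) : sl2 :=
  Subvs (comm_sl2_subproof (vsval x) (vsval y)).

End SL2.

Section Basis.
Variable C : numClosedFieldType.

Definition sl2_mx1 : 'M[C]_2 := 2^-1 *: (delta_mx 0 1 - delta_mx 1 0).
Definition sl2_mx2 : 'M[C]_2 := (2 * 'i)^-1 *: (delta_mx 0 1 + delta_mx 1 0).
Definition sl2_mx3 : 'M[C]_2 := (2 * 'i)^-1 *: (delta_mx 0 0 - delta_mx 1 1).

Fact sl2_mx1_subproof : sl2_mx1 \in sl2_vspace C.
Proof.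
by rewrite mem_sl2 /mxtrace !big_ord_recl big_ord0 !mxE /= !(subrr, mulr0, addr0).
Qed.
Fact sl2_mx2_subproof : sl2_mx2 \in sl2_vspace C.
Proof.
by rewrite mem_sl2 /mxtrace !big_ord_recl big_ord0 !mxE /= !(mulr0, addr0).
Qed.
Fact sl2_mx3_subproof : sl2_mx3 \in sl2_vspace C.
Proof.
rewrite mem_sl2 /mxtrace !big_ord_recl big_ord0 !mxE /=.
by rewrite subr0 sub0r addr0 mulrN subrr.
Qed.

Definition e1 : sl2 C := Subvs sl2_mx1_subproof.
Definition e2 : sl2 C := Subvs sl2_mx2_subproof.
Definition e3 : sl2 C := Subvs sl2_mx3_subproof.

Definition sl2_basis : 3.-tuple (sl2 C) := [tuple e1; e2; e3].

Local Notation br := sl2_br.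

Inductive postlie_index : Type :=
  | Rep1 | Rep2 | Rep3 | Rep4 | Rep5 of C.

(* The value prescribed for e_i o e_j, with i and j numbered from 0. *)
Definition rep_table (r : postlie_index) (i j : 'I_3) : sl2 C :=
  let y := tnth sl2_basis j in
  match r with
  | Rep1 => 0
  | Rep2 => br (- tnth sl2_basis i) y
  | Rep3 => tnth
      [tuple br (- e1) y;
             br (- ((1 + 'i) / 2) *: e2 + (('i - 1) / 2) *: e3) y;
             br (- ((1 + 'i) / 2) *: e2 + (('i - 1) / 2) *: e3) y] i
  | Rep4 => tnth
      [tuple br (('i - 1 / 2) *: e1 + (1 - 'i / 2) *: e2) y;
             br ((1 + 'i / 2) *: e1 - ('i + 1 / 2) *: e2) y;
             0] i
  | Rep5 k => tnth
      [tuple br (k *: e1) y;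
             br (- (1 / 2) *: e2 + ('i / 2) *: e3) y;
             br (- ('i / 2) *: e2 - (1 / 2) *: e3) y] i
  end.

Definition rep_op (r : postlie_index) (x y : sl2 C) : sl2 C :=
  \sum_(i < 3) \sum_(j < 3)
     (coord sl2_basis i x * coord sl2_basis j y) *: rep_table r i j.

Let two_i_neq0 : 2 * 'i != 0 :> C.
Proof. by rewrite mulf_neq0 ?neq0Ci ?pnatr_eq0. Qed.

Let sqi2 : 'i ^+ 2 = -1 :> C. Proof. exact: sqrCi. Qed.

Let sqi : 'i * 'i = -1 :> C. Proof. by rewrite -expr2 sqrCi. Qed.

Let two_i_V : (2 * 'i)^-1 = - ('i / 2) :> C.
Proof.
apply: (mulfI two_i_neq0); rewrite divff //.
have -> : 2 * 'i * - ('i / 2) = - ('i * 'i) :> C by field.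
by rewrite sqi opprK.
Qed.

Local Ltac entries :=
  apply: val_inj; apply/matrixP; case=> [[|[|[]]] //= ?]; case=> [[|[|[]]] //= ?];
  rewrite !mxE !big_ord_recl !big_ord0 !mxE /= ?two_i_V.

Lemma sl2_br12 : br e1 e2 = e3.
Proof. by entries; field. Qed.

Lemma sl2_br31 : br e3 e1 = e2.
Proof. by entries; field. Qed.

Lemma sl2_br23 : br e2 e3 = e1.
Proof.
by entries; field: sqi2.
Qed.

Lemma sl2_br_bilinear : bilinear_op (@sl2_br C).
Proof.
split=> z a x y; apply: val_inj; rewrite [RHS]linearP /=.
  by rewrite mulmxDl mulmxDr -scalemxAl -scalemxAr scalerBr opprD addrACA.
by rewrite mulmxDl mulmxDr -scalemxAl -scalemxAr scalerBr opprD addrACA.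
Qed.

Lemma sl2_basisP : basis_of fullv sl2_basis.
Proof.
apply/andP; split.
  rewrite eqEsubv subvf; apply/subvP=> x _.
  pose a : C := vsval x 0 0; pose b : C := vsval x 0 1; pose c : C := vsval x 1 0.
  have vx (i j i' j' : 'I_2) : i = i' :> nat -> j = j' :> nat -> vsval x i j = vsval x i' j'.
    by move=> ij ij'; congr (vsval x _ _); apply: val_inj.
  have xd : vsval x 1 1 = - a.
    have := valP x; rewrite mem_sl2 /mxtrace !big_ord_recl big_ord0 addr0.
    rewrite (vx (lift ord0 ord0) (lift ord0 ord0) 1 1) // (vx ord0 ord0 0 0) //.
    by rewrite addrC addr_eq0 => /eqP.
  have -> : x = (b - c) *: e1 + ('i * (b + c)) *: e2 + (2 * 'i * a) *: e3.
    apply: val_inj; apply/matrixP; case=> [[|[|[]]] //= ?]; case=> [[|[|[]]] //= ?];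
      rewrite !mxE /= ?two_i_V.
    - by rewrite (vx _ _ 0 0) // -/a; field: sqi2.
    - by rewrite (vx _ _ 0 1) // -/b; field: sqi2.
    - by rewrite (vx _ _ 1 0) // -/c; field: sqi2.
    - by rewrite (vx _ _ 1 1) // xd; field: sqi2.
  by rewrite !memvD // memvZ // memv_span // !inE eqxx ?orbT.
apply/freeP=> k; rewrite !big_ord_recl big_ord0 addr0 => /(congr1 vsval)/matrixP k0.
have := k0 0 0; have := k0 0 1; have := k0 1 0; rewrite !mxE /= {k0}.
move: (2 * 'i)^-1 (invr_neq0 two_i_neq0) => s s0.
rewrite !(subrr, addr0, subr0, add0r, sub0r, mulr0, mulr1) => h1 h2 /eqP h3.
have x0 : k ord0 = 0.
  apply: etrans (subrr 0); rewrite -[X in _ = X - _]h2 -[X in _ = _ - X]h1.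
  by field.
move: h2 h3 => /eqP; rewrite x0 mul0r add0r !mulf_eq0 (negbTE s0) !orbF => /eqP y0 /eqP z0.
by case=> [[|[|[|[]]]] //= ?]; [rewrite -[RHS]x0 | rewrite -[RHS]y0 | rewrite -[RHS]z0];
  congr k; apply: val_inj.
Qed.

Lemma rep_op_bilinear r : bilinear_op (rep_op r).
Proof.
split=> z a x y; rewrite /rep_op scaler_sumr -big_split; apply: eq_bigr => i _;
  rewrite scaler_sumr -big_split; apply: eq_bigr => j _ /=;
  rewrite linearP /= scalerA -scalerDl; congr (_ *: _); ring.
Qed.

Lemma rep_opE r i j :
  rep_op r (tnth sl2_basis i) (tnth sl2_basis j) = rep_table r i j.
Proof.
have coordE k l : coord sl2_basis k (tnth sl2_basis l) = (k == l)%:R.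
  by rewrite (tnth_nth 0) coord_free ?(basis_free sl2_basisP) // eq_sym.
rewrite /rep_op (bigD1 i) //= (bigD1 j) //= !coordE !eqxx mulr1 scale1r.
rewrite !big1 ?addr0 // => [k /negbTE ne_k|k /negbTE ne_k].
  by rewrite big1 // => l _; rewrite coordE ne_k mul0r scale0r.
by rewrite coordE ne_k mulr0 scale0r.
Qed.

End Basis.

(* Main.v *)
Require Import Defs.
From HB Require Import structures.
From mathcomp Require Import all_boot all_order all_algebra.
From mathcomp Require Import spectral ring.
Import Order.TTheory GRing.Theory Num.Theory.
Local Open Scope ring_scope.

(** In a PostLie structure on sl2 every left multiplication is a derivation of the
    bracket, hence inner ([derivation_inner]). So the operation is
    x o y = [phi x, y] for a linear map phi, and the remaining PostLie axiom says
    that phi is a Rota-Baxter operator of weight 1 ([postlie_op_is_br],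
    [postlie_rota_baxter]). As sl2 has no center, isomorphisms of PostLie
    structures are the Lie automorphisms conjugating one operator into the other,
    and the theorem becomes a classification of Rota-Baxter operators up to
    conjugacy.

    All computations take place in sl2-triples h, e, f, where [h, e] = 2 e,
    [h, f] = - 2 f and [e, f] = h. Any two triples are exchanged by an
    automorphism, so two operators given by the same formulas in two triples are
    conjugate ([normal_form_isomorphic]), and it is enough to find for each
    operator a triple in which it has one of five normal forms.

    The key point is that a Rota-Baxter operator phi has a nilpotent eigenvector
    ([rota_baxter_nilpotent_eigenvector]). Some eigenvector exists, and if it is
    not nilpotent it is a multiple of the h of a triple; the Rota-Baxter relation
    is then restrictive enough to exhibit a nilpotent eigenvector. Completing such
    an eigenvector e to a triple, the relation forces its eigenvalue to be 0 or
    -1. The symmetry exchanging phi and - id - phi reduces to phi e = 0; there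
    phi is triangular, and the stabilizer of the line of e, generated by
    exp (t ad e) and rescalings, brings it to normal form ([normalize_kernel]).

    The normal form is unique ([normal_form_unique]): the trace of phi leaves only
    a few pairs to distinguish, and these differ by the vanishing of phi or of
    phi + id, or by whether the line on which phi is 0 or -1 is nilpotent. *)

Set Implicit Arguments.
Unset Strict Implicit.
Unset Printing Implicit Defensive.

(** * Combinations of three vectors and the bracket of sl2 *)

(** Sealed: such combinations are compared only through their coordinates. *)
HB.lock Definition lincomb (C : numClosedFieldType) (h e f : sl2 C) (a b c : C) : sl2 C :=
  a *: h + b *: e + c *: f.

Section SL2Triples.
Variable C : numClosedFieldType.
Local Notation L := (sl2 C).
Local Notation br := (@sl2_br C).
Implicit Types (a b c d k l : C) (x y z h e f : L).

Lemma two_neq0 : 2 != 0 :> C.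
Proof. by rewrite pnatr_eq0. Qed.

(** Extracts from an equation u = v the relation a = b of which it is the multiple
    by k, so that only a ring identity remains to be checked. *)
Lemma eq_of_multiple k a b u v : k != 0 -> u = v -> k * (a - b) = u - v -> a = b.
Proof.
move=> nz_k -> /eqP; rewrite subrr mulf_eq0 (negPf nz_k) subr_eq0.
exact: eqP.
Qed.

Lemma brDl x y z : br (x + y) z = br x z + br y z.
Proof. by have := (sl2_br_bilinear C).2 z 1 x y; rewrite /= !scale1r. Qed.

Lemma brDr x y z : br z (x + y) = br z x + br z y.
Proof. by have := (sl2_br_bilinear C).1 z 1 x y; rewrite /= !scale1r. Qed.

Lemma br_antisym x y : br x y = - br y x.
Proof. by apply: val_inj; rewrite /= opprB. Qed.

Lemma brxx x : br x x = 0.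
Proof. by apply: val_inj; rewrite /= subrr. Qed.

Lemma br0 x : br x 0 = 0.
Proof. by apply: val_inj; rewrite /= mulmx0 mul0mx subrr. Qed.

Lemma brZr a x y : br x (a *: y) = a *: br x y.
Proof. by have := (sl2_br_bilinear C).1 x a y 0; rewrite !addr0 br0 addr0. Qed.

Lemma brZl a x y : br (a *: x) y = a *: br x y.
Proof. by rewrite br_antisym brZr -scalerN -br_antisym. Qed.

Lemma brNr x y : br x (- y) = - br x y.
Proof. by rewrite -scaleN1r brZr scaleN1r. Qed.

Lemma brNl x y : br (- x) y = - br x y.
Proof. by rewrite -scaleN1r brZl scaleN1r. Qed.

Lemma br_jacobi x y z : br (br x y) z + br (br z x) y + br (br y z) x = 0.
Proof.
apply: val_inj; rewrite /= !(mulmxBl, mulmxBr) !mulmxA.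
set u1 := vsval x *m vsval y *m vsval z.
set u2 := vsval z *m vsval x *m vsval y.
set u3 := vsval y *m vsval z *m vsval x.
set u4 := vsval y *m vsval x *m vsval z.
set u5 := vsval z *m vsval y *m vsval x.
set u6 := vsval x *m vsval z *m vsval y.
apply/matrixP=> i j; rewrite !mxE; ring.
Qed.

Lemma lincomb_def h e f a b c : lincomb h e f a b c = a *: h + b *: e + c *: f.
Proof. by rewrite lincomb.unlock. Qed.

Lemma lincombD h e f a b c a' b' c' :
  lincomb h e f a b c + lincomb h e f a' b' c' = lincomb h e f (a + a') (b + b') (c + c').
Proof. by rewrite !lincomb_def !scalerDl addrACA [in LHS](addrACA (a *: h)). Qed.

Lemma lincombZ h e f d a b c : d *: lincomb h e f a b c =
    lincomb h e f (d * a) (d * b) (d * c).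
Proof. by rewrite !lincomb_def !scalerDr !scalerA. Qed.

Lemma lincombN h e f a b c : - lincomb h e f a b c = lincomb h e f (- a) (- b) (- c).
Proof. by rewrite !lincomb_def !scaleNr !opprD. Qed.

Lemma lincomb_h h e f : h = lincomb h e f 1 0 0.
Proof. by rewrite !lincomb_def !scale0r scale1r !addr0. Qed.

Lemma lincomb_e h e f : e = lincomb h e f 0 1 0.
Proof. by rewrite !lincomb_def !scale0r scale1r add0r addr0. Qed.

Lemma lincomb_f h e f : f = lincomb h e f 0 0 1.
Proof. by rewrite !lincomb_def !scale0r scale1r !add0r. Qed.

Lemma lincomb_0 h e f : 0 = lincomb h e f 0 0 0.
Proof. by rewrite !lincomb_def !scale0r !addr0. Qed.

Lemma lincombE h e f a b c a' b' c' : a = a' -> b = b' -> c = c' ->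
  lincomb h e f a b c = lincomb h e f a' b' c'.
Proof. by move=> -> -> ->. Qed.

Lemma linear_lincomb (V : lmodType C) (phi : {linear L -> V}) h e f a b c :
  phi (lincomb h e f a b c) = a *: phi h + b *: phi e + c *: phi f.
Proof. by rewrite !lincomb_def !linearD !linearZ. Qed.

(** * sl2-triples *)

(** Only e is asked to be nonzero: the bracket relations then force h and f to be
    nonzero, and h, e, f to be a basis. *)
Definition is_triple h e f :=
  [/\ br h e = 2 *: e, br h f = - 2 *: f, br e f = h & e != 0].

Section Coordinates.
Variables (h e f : L).
Hypothesis hef : is_triple h e f.
Local Notation co := (lincomb h e f).

Lemma br_lincomb a b c a' b' c' :
  br (co a b c) (co a' b' c')
    = co (b * c' - c * b') (2 * (a * b' - b * a')) (2 * (c * a' - a * c')).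
Proof.
have [he hf ef _] := hef.
have he' : br h e = co 0 2 0 by rewrite he !lincomb_def !scale0r add0r addr0.
have hf' : br h f = co 0 0 (- 2) by rewrite hf !lincomb_def !scale0r !add0r.
have ef' : br e f = co 1 0 0 by rewrite ef -lincomb_h.
rewrite ![in LHS]lincomb_def !(brDl, brDr, brZl, brZr) !brxx.
rewrite (br_antisym e h) (br_antisym f h) (br_antisym f e) he' hf' ef' (lincomb_0 h e f).
rewrite !(lincombN, lincombZ, lincombD); apply: lincombE; ring.
Qed.

(** Bracketing twice with e isolates the coefficient of f, and bracketing once
    then isolates that of h. *)
Lemma lincomb_eq0 a b c : co a b c = 0 -> [/\ a = 0, b = 0 & c = 0].
Proof.
have [_ _ _ nz_e] := hef => x0.
have scal_e d : co 0 d 0 = 0 -> d = 0.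
  by rewrite !lincomb_def !scale0r add0r addr0 => /eqP;
    rewrite scaler_eq0 (negPf nz_e) orbF => /eqP.
have x1 : br e (co a b c) = 0 by rewrite x0 br0.
have x2 : br e (br e (co a b c)) = 0 by rewrite x1 br0.
have two0 := two_neq0.
have c0 : c = 0.
  move: x2; rewrite {1 2}(lincomb_e h e f) !br_lincomb => x2.
  have /eqP : - (2 * c) = 0 by apply: scal_e; rewrite -x2; apply: lincombE; ring.
  by rewrite oppr_eq0 mulf_eq0 (negPf two0) => /eqP.
have a0 : a = 0.
  move: x1; rewrite {1}(lincomb_e h e f) br_lincomb c0 => x1.
  have /eqP : - (2 * a) = 0 by apply: scal_e; rewrite -x1; apply: lincombE; ring.
  by rewrite oppr_eq0 mulf_eq0 (negPf two0) => /eqP.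
by split=> //; apply: scal_e; rewrite -x0 a0 c0.
Qed.

Lemma lincomb_inj a b c a' b' c' :
  co a b c = co a' b' c' -> [/\ a = a', b = b' & c = c'].
Proof.
move=> /eqP; rewrite -subr_eq0 lincombN lincombD => /eqP.
move=> /lincomb_eq0[/eqP a0 /eqP b0 /eqP c0].
by split; apply/eqP; rewrite -subr_eq0.
Qed.

Definition triple_tuple : 3.-tuple L := [tuple h; e; f].

Lemma triple_basis : basis_of fullv triple_tuple.
Proof.
rewrite basisEfree subvf (size_basis (sl2_basisP C)) size_tuple leqnn !andbT.
apply/freeP=> k; rewrite !big_ord_recl big_ord0 addr0 /= addrA -lincomb_def =>
  /lincomb_eq0[k0 k1 k2].
by case=> [[|[|[|]]] // ?]; [rewrite -[RHS]k0 | rewrite -[RHS]k1 | rewrite -[RHS]k2];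
  congr k; apply: val_inj.
Qed.

Lemma lincomb_surj x : exists a b c, x = co a b c.
Proof.
rewrite (coord_basis triple_basis (memvf x)) !big_ord_recl big_ord0 addr0 addrA.
move: (coord _ _ x) (coord _ _ x) (coord _ _ x) => c b a.
by exists a, b, c; rewrite lincomb_def.
Qed.

Lemma linear_on_triple (u v w : L) :
  exists phi : {linear L -> L}, [/\ phi h = u, phi e = v & phi f = w].
Proof.
have [phi phiE] := linear_of_free triple_tuple [:: u; v; w].
by exists phi; have [] := phiE (basis_free triple_basis) erefl.
Qed.

Lemma linear_triple_ext (V : lmodType C) (phi psi : {linear L -> V}) :
  phi h = psi h -> phi e = psi e -> phi f = psi f -> phi =1 psi.
Proof.
by move=> hE eE fE x; have [a [b [c ->]]] := lincomb_surj x;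
  rewrite !linear_lincomb hE eE fE.
Qed.

(** Applying the Leibniz rule to the three bracket relations of the triple leaves
    three free coefficients in the matrix of a derivation, as many as the
    coordinates of u. *)
Lemma derivation_inner (D : {linear L -> L}) :
  (forall x y, D (br x y) = br (D x) y + br x (D y)) ->
  exists u, forall y, D y = br u y.
Proof.
move=> derD.
have [a1 [b1 [c1 Dh]]] := lincomb_surj (D h).
have [a2 [b2 [c2 De]]] := lincomb_surj (D e).
have [a3 [b3 [c3 Df]]] := lincomb_surj (D f).
have two0 := two_neq0.
have DE a b c : D (co a b c) = co (a * a1 + b * a2 + c * a3)
    (a * b1 + b * b2 + c * b3) (a * c1 + b * c2 + c * c3).
  by rewrite linear_lincomb Dh De Df !(lincombZ, lincombD).
(* Read off from [u, h] and [u, e] for a general u. *)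
exists (co (b2 / 2) (- (b1 / 2)) (c1 / 2)) => y.
have [a [b [c ->]]] := lincomb_surj y.
have := derD (co 1 0 0) (co 0 1 0); have := derD (co 1 0 0) (co 0 0 1).
have := derD (co 0 1 0) (co 0 0 1).
rewrite !(br_lincomb, DE, lincombD) => /lincomb_inj[E1 E2 E3] /lincomb_inj[E4 E5 E6]
  /lincomb_inj[E7 E8 E9].
have a1_0 : a1 = 0 by apply: (eq_of_multiple (k := - 2) _ E8); rewrite ?oppr_eq0 //; ring.
have c2_0 : c2 = 0 by apply: (eq_of_multiple (k := 4) _ E9); rewrite ?pnatr_eq0 //; ring.
have b3_0 : b3 = 0 by apply: (eq_of_multiple (k := - 4) _ E5);
  rewrite ?oppr_eq0 ?pnatr_eq0 //; ring.
have a2E : a2 = - (c1 / 2) by apply: (eq_of_multiple (k := 2) _ E7) => //; field.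
have a3E : a3 = - (b1 / 2) by apply: (eq_of_multiple (k := - 2) _ E4); rewrite ?oppr_eq0 //;
  field.
have c3E : c3 = - b2 by apply: (eq_of_multiple (k := - 1) _ E1);
  rewrite ?oppr_eq0 ?oner_eq0 // a1_0; ring.
by rewrite a1_0 c2_0 b3_0 a2E a3E c3E; apply: lincombE; field.
Qed.
End Coordinates.
End SL2Triples.

(** * Moving a vector into an sl2-triple *)

Section TripleMoves.
Variable C : numClosedFieldType.
Local Notation L := (sl2 C).
Local Notation br := (@sl2_br C).
Implicit Types (a b c d k l : C) (x y z h e f : L) (phi : {linear L -> L}).

Section Moves.
Variables (h e f : L).
Hypothesis hef : is_triple h e f.
Local Notation co := (lincomb h e f).

Lemma lincomb_neq0 a b c : [|| a != 0, b != 0 | c != 0] -> co a b c != 0.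
Proof.
move=> nz; apply/eqP => /(lincomb_eq0 hef)[a0 b0 c0].
by rewrite a0 b0 c0 eqxx in nz.
Qed.

Lemma triple_swap : is_triple (- h) f e.
Proof.
have [he hf ef _] := hef.
split; rewrite ?brNl ?he ?hf.
- by rewrite scaleNr opprK.
- by rewrite scaleNr.
- by rewrite br_antisym ef.
- by rewrite (lincomb_f h e f) lincomb_neq0 // oner_neq0 !orbT.
Qed.

Lemma triple_scale d : d != 0 -> is_triple h (d *: e) (d^-1 *: f).
Proof.
have [he hf ef e0] := hef => nz_d; split.
- by rewrite brZr he !scalerA mulrC.
- by rewrite brZr hf !scalerA mulrC.
- by rewrite brZl brZr ef scalerA divff ?scale1r.
- by rewrite scaler_eq0 negb_or nz_d.
Qed.

(** This is the image of the triple under the automorphism exp (t ad e). *)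
Lemma triple_shift t : is_triple (co 1 (- (2 * t)) 0) e (co t (- t ^+ 2) 1).
Proof.
suff : is_triple (co 1 (- (2 * t)) 0) (co 0 1 0) (co t (- t ^+ 2) 1) by rewrite -lincomb_e.
split; last by rewrite lincomb_neq0 // oner_neq0 orbT.
all: by rewrite (br_lincomb hef) ?lincombZ; apply: lincombE; ring.
Qed.

(** For the 2 x 2 matrix x = [[a, b], [c, - a]] with eigenvalues 1 and -1, the
    columns (1 + a, c) and (- b, 1 + a) are eigenvectors, independent because
    their determinant is 2 (1 + a). The matrix e' kills the first and maps the second
    to the first; f' does the opposite. *)
Lemma unit_semisimple_in_triple a b c : a ^+ 2 + b * c = 1 -> 1 + a != 0 ->
  exists e' f', is_triple (co a b c) e' f'.
Proof.
move=> norm1 nz_a; have two0 := two_neq0 C.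
exists (co (- (c / 2)) ((1 + a) / 2) (- (c ^+ 2 / (2 * (1 + a))))).
exists (co (- (b / 2)) (- (b ^+ 2 / (2 * (1 + a)))) ((1 + a) / 2)).
have bcE : b * c = 1 - a ^+ 2 by rewrite -norm1 addrC addrA addNr add0r.
split; rewrite ?(br_lincomb hef) ?lincombZ; last first.
  by rewrite lincomb_neq0 // mulf_neq0 ?invr_eq0 ?orbT.
all: apply: lincombE; field: bcE; rewrite ?nz_a //.
Qed.
End Moves.

(** The quantity a ^+ 2 + b * c is minus the determinant of the vector as a 2 x 2
    matrix. When it vanishes and c does not, the vector is c times the image of f
    under exp ((a / c) ad e). *)
Lemma nilpotent_in_triple h e f a b c : is_triple h e f ->
  lincomb h e f a b c != 0 -> a ^+ 2 + b * c = 0 ->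
  exists h' f', is_triple h' (lincomb h e f a b c) f'.
Proof.
move=> hef nz_x norm0; have [c0 | c0] := eqVneq c 0.
  have a0 : a = 0.
    by move/eqP: norm0; rewrite c0 mulr0 addr0 sqrf_eq0 => /eqP.
  have b0 : b != 0.
    by apply: contraNneq nz_x => b0; rewrite a0 b0 c0 -lincomb_0.
  exists h, (b^-1 *: f).
  by rewrite lincomb_def a0 c0 !scale0r add0r addr0; apply: triple_scale.
have x_f1 : lincomb h e f a b c = c *: lincomb h e f (a / c) (- (a / c) ^+ 2) 1.
  rewrite lincombZ; apply: lincombE; [by field | | by rewrite mulr1].
  by apply: (eq_of_multiple (k := c) c0 norm0); field.
rewrite x_f1; have t := triple_scale (triple_swap (triple_shift hef (a / c))) c0.
by do 2!eexists; exact: t.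
Qed.

(** After division by s the vector falls under [unit_semisimple_in_triple], in the
    triple h, e, f or, if 1 + a vanishes there, in the opposite triple - h, f, e,
    where the first coordinate is 1. *)
Lemma semisimple_in_triple h e f a b c s : is_triple h e f ->
  s ^+ 2 = a ^+ 2 + b * c -> s != 0 ->
  exists h' e' f', is_triple h' e' f' /\ lincomb h e f a b c = s *: h'.
Proof.
move=> hef s2 nz_s; have two0 := two_neq0 C.
have xE : lincomb h e f a b c = s *: lincomb h e f (a / s) (b / s) (c / s).
  by rewrite lincombZ; apply: lincombE; field.
have norm1 : (a / s) ^+ 2 + b / s * (c / s) = 1.
  apply: (eq_of_multiple (k := s ^+ 2) _ (esym s2)); first by rewrite expf_neq0.
  by field.
have [a_s | nz_a] := eqVneq (1 + a / s) 0; last first.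
  have [e' [f' t]] := unit_semisimple_in_triple hef norm1 nz_a.
  by rewrite xE; exists (lincomb h e f (a / s) (b / s) (c / s)), e', f'.
have [||e' [f' t]] := @unit_semisimple_in_triple (- h) f e (triple_swap hef)
                     (- (a / s)) (c / s) (b / s).
- by rewrite -norm1; ring.
- have -> : - (a / s) = 1 by
    apply: (eq_of_multiple (k := -1) _ a_s); [rewrite oppr_eq0 oner_eq0 | ring].
  by [].
exists (lincomb (- h) f e (- (a / s)) (c / s) (b / s)), e', f'; split=> //.
rewrite xE; congr (_ *: _).
by rewrite !lincomb_def scalerN scaleNr opprK addrAC.
Qed.
End TripleMoves.

(** * Nilpotent eigenvectors of Rota-Baxter operators *)

Section NilpotentEigenvector.
Import VectorInternalTheory.
Variable C : numClosedFieldType.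
Local Notation L := (sl2 C).
Local Notation br := (@sl2_br C).
Implicit Types (a b c d k l : C) (x y z h e f : L) (phi : {linear L -> L}).

(** A Rota-Baxter operator of weight 1. *)
Definition rota_baxter phi :=
  forall x y, br (phi x) (phi y) = phi (br (phi x) y + br x (phi y) + br x y).

(** The nilpotent elements of sl2 are 0 and the second members of triples. *)
Definition nilpotent_eigenvector phi :=
  exists h e f l, is_triple h e f /\ phi e = l *: e.

Lemma linear_coords phi h e f a1 b1 c1 a2 b2 c2 a3 b3 c3 a b c :
    phi h = lincomb h e f a1 b1 c1 -> phi e = lincomb h e f a2 b2 c2 ->
    phi f = lincomb h e f a3 b3 c3 ->
  phi (lincomb h e f a b c) = lincomb h e f (a * a1 + b * a2 + c * a3)
    (a * b1 + b * b2 + c * b3) (a * c1 + b * c2 + c * c3).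
Proof. by move=> hE eE fE; rewrite linear_lincomb hE eE fE !(lincombZ, lincombD). Qed.

Local Notation e1 := (e1 C).
Local Notation e2 := (e2 C).
Local Notation e3 := (e3 C).
Local Notation E := (lincomb e1 e2 e3).

(** On the basis e1, e2, e3 the bracket is the cross product. *)
Lemma br_sl2_basis a b c a' b' c' :
  br (E a b c) (E a' b' c')
    = E (b * c' - c * b') (c * a' - a * c') (a * b' - b * a').
Proof.
have e12 : br e1 e2 = E 0 0 1 by rewrite -lincomb_f sl2_br12.
have e31 : br e3 e1 = E 0 1 0 by rewrite -lincomb_e sl2_br31.
have e23 : br e2 e3 = E 1 0 0 by rewrite -lincomb_h sl2_br23.
rewrite ![in LHS]lincomb_def !(brDl, brDr, brZl, brZr) !brxx.
rewrite (br_antisym e2 e1) (br_antisym e1 e3) (br_antisym e3 e2) e12 e31 e23.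
rewrite (lincomb_0 e1 e2 e3) !(lincombN, lincombZ, lincombD); apply: lincombE; ring.
Qed.

Lemma sl2_basis_lincomb_neq0 a b c : [|| a != 0, b != 0 | c != 0] -> E a b c != 0.
Proof.
apply: contraLR; rewrite negbK !negb_or !negbK => /eqP E0.
have /freeP fr := basis_free (sl2_basisP C).
pose k (i : 'I_3) := tnth [tuple a; b; c] i.
have k0 := fr k; rewrite !big_ord_recl big_ord0 addr0 /= addrA -lincomb_def in k0.
have {}k0 := k0 E0.
have [[k1 k2] k3] := (k0 ord0, k0 (lift ord0 ord0), k0 (lift ord0 (lift ord0 ord0))).
by rewrite (k1 : a = 0) (k2 : b = 0) (k3 : c = 0) !eqxx.
Qed.

Let i2 : 'i ^+ 2 = -1 :> C := sqrCi C.

(** In this and the next two lemmas, the lines spanned by h, e and f are chosen so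
    that the operator of the third, fourth and fifth representative is triangular
    on the triple. *)
Lemma rep3_triple : is_triple (E (- (2 * 'i)) 0 0) (E 0 1 (- 'i)) (E 0 (- 1) (- 'i)).
Proof.
split; rewrite ?br_sl2_basis ?lincombZ ?sl2_basis_lincomb_neq0 ?oner_neq0 ?orbT //;
  apply: lincombE; ring: i2.
Qed.

Lemma rep4_triple : is_triple (E 0 0 (- (2 * 'i))) (E 1 (- 'i) 0) (E (- 1) (- 'i) 0).
Proof.
split; rewrite ?br_sl2_basis ?lincombZ ?sl2_basis_lincomb_neq0 ?oner_neq0 ?orbT //;
  apply: lincombE; ring: i2.
Qed.

Lemma rep5_triple : is_triple (E (2 * 'i) 0 0) (E 0 1 'i) (E 0 (- 1) 'i).
Proof.
split; rewrite ?br_sl2_basis ?lincombZ ?sl2_basis_lincomb_neq0 ?oner_neq0 ?orbT //;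
  apply: lincombE; ring: i2.
Qed.

Lemma exists_triple : exists h e f, is_triple h e f.
Proof. by do 3!eexists; exact: rep5_triple. Qed.

Lemma exists_eigenvector phi : exists x l, x != 0 /\ phi x = l *: x.
Proof.
pose A := f2mx (linfun phi).
have dim_gt0 : (0 < dim L)%N.
  by rewrite -dimvf (size_basis (sl2_basisP C)).
have [l /eigenvalueP[v vA nz_v]] := eigenvalue_closed A dim_gt0.
exists (r2v v), l; split.
  by apply: contraNneq nz_v => /(congr1 v2r); rewrite r2vK linear0 => ->.
by rewrite -linearZ -vA -lfunE unlock /= r2vK.
Qed.

(** The Rota-Baxter relation on the pairs (h, e), (h, f) and (e, f) gives equations
    for the six coordinates of phi e and phi f. Unless e or f is an eigenvector
    they force phi e = a h + b e and phi f = p h + b f with a p = - 1 / 4, and the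
    nilpotent eigenvector is then a combination of all three vectors. *)
Lemma semisimple_eigenvector phi h e f l : rota_baxter phi ->
  is_triple h e f -> phi h = l *: h -> nilpotent_eigenvector phi.
Proof.
move=> rb hef phi_h; have two0 := two_neq0 C.
have [a [b [c phi_e]]] := lincomb_surj hef (phi e).
have [p [q [r phi_f]]] := lincomb_surj hef (phi f).
have hE : phi h = lincomb h e f l 0 0 by rewrite phi_h lincomb_def !scale0r !addr0.
have phiE := linear_coords _ _ _ hE phi_e phi_f.
have := rb (lincomb h e f 0 1 0) (lincomb h e f 0 0 1).
have := rb (lincomb h e f 1 0 0) (lincomb h e f 0 0 1).
have := rb (lincomb h e f 1 0 0) (lincomb h e f 0 1 0).
rewrite !(phiE, br_lincomb hef, lincombD).
move=> /(lincomb_inj hef)[E1 E2 E3] /(lincomb_inj hef)[E4 E5 E6]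
  /(lincomb_inj hef)[E7 E8 E9].
have four0 : (4 : C) != 0 by rewrite pnatr_eq0.
have R1 : (l + 1 + b) * a = c * p by apply: (eq_of_multiple (k := -2) _ E1);
  [rewrite oppr_eq0|ring].
have R2 : b + b ^+ 2 = c * q by apply: (eq_of_multiple (k := -2) _ E2);
  [rewrite oppr_eq0|ring].
have R3 : c * (2 * l + 1 + b - r) = 0 by apply: (eq_of_multiple (k := -2) _ E3);
  [rewrite oppr_eq0|ring].
have R4 : (l + 1 + r) * p = q * a by apply: (eq_of_multiple (k := 2) _ E4); [|ring].
have R5 : q * (2 * l + 1 + r - b) = 0 by apply: (eq_of_multiple (k := 2) _ E5); [|ring].
have R6 : r + r ^+ 2 = q * c by apply: (eq_of_multiple (k := 2) _ E6); [|ring].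
have R7 : b * r - c * q = (b + r + 1) * l - 4 * a * p
  by apply: (eq_of_multiple (k := 1) _ E7); [rewrite oner_eq0|ring].
have R8 : a * q = 0 by apply: (eq_of_multiple (k := 4) _ E8); [|ring].
have R9 : p * c = 0 by apply: (eq_of_multiple (k := 4) _ E9); [|ring].
have eig_e : a = 0 -> c = 0 -> nilpotent_eigenvector phi.
  by move=> a0 c0; exists h, e, f, b; rewrite phi_e a0 c0 lincomb_def !scale0r add0r addr0.
have eig_f : p = 0 -> q = 0 -> nilpotent_eigenvector phi.
  move=> p0 q0; exists (- h), f, e, r; split; first exact: triple_swap.
  by rewrite phi_f p0 q0 lincomb_def !scale0r !add0r.
have [c0 | nz_c] := eqVneq c 0; last first.
  have p0 : p = 0 by move/eqP: R9; rewrite mulf_eq0 (negPf nz_c) orbF => /eqP.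
  have [q0 | nz_q] := eqVneq q 0; first exact: eig_f.
  have rE : r = 2 * l + 1 + b.
    by move/eqP: R3; rewrite mulf_eq0 (negPf nz_c) subr_eq0 => /eqP.
  have lE : 2 * l + 1 = 0.
    move/eqP: R5; rewrite mulf_eq0 (negPf nz_q) rE => /eqP lE.
    by apply: (eq_of_multiple (k := 2) _ lE) => //; ring.
  have bE : r = b by rewrite rE lE add0r.
  (* Now r = b and l = - 1 / 2, and R2 and R7 become contradictory. *)
  suff /eqP : (1 : C) = 0 by rewrite oner_eq0.
  move: R7; rewrite -R2 bE p0 => R7.
  have lE' := congr1 ( *%R (2 * b + 1)) lE.
  apply: (eq_of_multiple (k := 1)
    (u := 2 * (b * b - (b + b ^+ 2)) + (2 * b + 1) * (2 * l + 1))
    (v := 2 * ((b + b + 1) * l - 4 * a * 0) + (2 * b + 1) * 0)).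
  - by rewrite oner_eq0.
  - by rewrite R7 lE'.
  - by ring.
have [q0 | nz_q] := eqVneq q 0; last first.
  by apply: eig_e => //; move/eqP: R8; rewrite mulf_eq0 (negPf nz_q) orbF => /eqP.
have [a0 | nz_a] := eqVneq a 0; first exact: eig_e.
have [p0 | nz_p] := eqVneq p 0; first exact: eig_f.
have bE : b = - (l + 1).
  move/eqP: R1; rewrite c0 mul0r mulf_eq0 (negPf nz_a) orbF addrC addr_eq0.
  by move/eqP.
have rE : r = - (l + 1).
  move/eqP: R4; rewrite q0 mul0r mulf_eq0 (negPf nz_p) orbF addrC addr_eq0.
  by move/eqP.
have l2 : l ^+ 2 = - l.
  move/eqP: R2; rewrite c0 mul0r bE => /eqP R2.
  by apply: (eq_of_multiple (k := 1) _ R2); [rewrite oner_eq0 | ring].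
have norm0 : 4 * (a * p) = -1.
  apply: (eq_of_multiple (k := 1) _ R7); first by rewrite oner_eq0.
  by rewrite c0 q0 rE bE; ring: l2.
(* As b is 0 or -1, s is 2 or -2: the two values of b need opposite signs. *)
pose s := 2 * (2 * b + 1).
have nz_n : lincomb h e f 1 (- (s * p)) (- (s * a)) != 0
  by rewrite lincomb_neq0 // oner_neq0.
have [|h' [f' t]] := nilpotent_in_triple hef nz_n.
  rewrite /s bE; apply: (eq_of_multiple (k := 1) _ norm0); first by rewrite oner_eq0.
  by ring: l2.
exists h', (lincomb h e f 1 (- (s * p)) (- (s * a))), f', b; split=> //.
have lE : 1 * l + - (s * p) * a + - (s * a) * p = l - 2 * s * (a * p) by ring.
rewrite phiE lincombZ {}lE; apply: lincombE; rewrite /s ?c0 ?q0 ?rE ?bE.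
- have -> : a * p = - 4^-1 by apply: (mulfI four0); rewrite norm0 mulrN divff.
  by field.
- by ring: l2.
- by ring: l2.
Qed.

(** Over an algebraically closed field some eigenvector exists; it is nilpotent or
    a multiple of the first member of a triple. *)
Lemma rota_baxter_nilpotent_eigenvector phi :
  rota_baxter phi -> nilpotent_eigenvector phi.
Proof.
move=> rb; have [x [l [nz_x phi_x]]] := exists_eigenvector phi.
have [h [e [f hef]]] : exists h e f, is_triple h e f by exact: exists_triple.
have [a [b [c xE]]] := lincomb_surj hef x; rewrite xE in nz_x phi_x.
have [norm0 | nz_norm] := eqVneq (a ^+ 2 + b * c) 0.
  have [h' [f' t]] := nilpotent_in_triple hef nz_x norm0.
  by exists h', (lincomb h e f a b c), f', l.
have nz_s : sqrtC (a ^+ 2 + b * c) != 0 by rewrite sqrtC_eq0.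
have [h' [e' [f' [t xE']]]] := semisimple_in_triple hef (sqrtCK _) nz_s.
apply: (semisimple_eigenvector (l := l) rb t).
apply: (scalerI nz_s).
by rewrite -linearZ /= -xE' phi_x xE' scalerA mulrC -scalerA.
Qed.
End NilpotentEigenvector.

(** * Normal forms of Rota-Baxter operators *)

Section NormalForms.
Variable C : numClosedFieldType.
Local Notation L := (sl2 C).
Local Notation br := (@sl2_br C).
Implicit Types (a b c d k l : C) (x y z h e f : L) (phi : {linear L -> L}).

(** Rescaling e to d e and f to f / d divides the coefficient of e in phi f by
    d ^+ 2, so the constants of the third and fourth form could be any nonzero
    numbers; with these ones, the listed representatives have their normal form in
    triples whose coordinates on e1, e2, e3 lie in Q(i). *)
Definition normal_form phi (r : postlie_index C) h e f : Prop :=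
  match r with
  | Rep1 => [/\ phi h = 0, phi e = 0 & phi f = 0]
  | Rep2 => [/\ phi h = - h, phi e = - e & phi f = - f]
  | Rep3 => [/\ phi h = - h, phi e = - e & phi f = 'i *: e]
  | Rep4 => [/\ phi h = 0, phi e = 0 & phi f = - (2 * 'i) *: e - f]
  | Rep5 k => [/\ phi h = k *: h, phi e = 0 & phi f = - f]
  end.

Definition has_normal_form phi r :=
  exists h e f, is_triple h e f /\ normal_form phi r h e f.

(** The Rota-Baxter relation makes phi triangular, with phi f = p e + q h + r f for r
    equal to 0 or -1. If r = 0, phi vanishes. If r = -1, a conjugation by
    exp (t ad e) removes the off-diagonal coefficients when b, the eigenvalue on h,
    is nonzero; when b = 0 it leaves a multiple of e in phi f, which is zero or can
    be normalized by rescaling. *)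
Lemma normalize_kernel phi h e f : rota_baxter phi -> is_triple h e f ->
  phi e = 0 -> exists r, has_normal_form phi r.
Proof.
move=> rb hef phi_e; have two0 := two_neq0 C.
have [b [a [c phi_h]]] := lincomb_surj hef (phi h).
have [q [p [r phi_f]]] := lincomb_surj hef (phi f).
have eE : phi e = lincomb h e f 0 0 0 by rewrite phi_e -lincomb_0.
have phiE := linear_coords _ _ _ phi_h eE phi_f.
have := rb (lincomb h e f 0 1 0) (lincomb h e f 0 0 1).
have := rb (lincomb h e f 1 0 0) (lincomb h e f 0 0 1).
have := rb (lincomb h e f 1 0 0) (lincomb h e f 0 1 0).
rewrite !(phiE, br_lincomb hef, lincombD).
move=> /(lincomb_inj hef)[E1 E2 E3] /(lincomb_inj hef)[E4 E5 E6]
  /(lincomb_inj hef)[E7 E8 E9].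
have c0 : c = 0.
  by apply/eqP; rewrite -sqrf_eq0; apply/eqP; apply: (eq_of_multiple (k := 1) _ E3);
    rewrite ?oner_eq0 //; ring.
have R1 : (r + 1) * b = 0 by apply: (eq_of_multiple (k := -1) _ E7);
  [rewrite oppr_eq0 oner_eq0|ring].
have R2 : (r + 1) * a = 0 by apply: (eq_of_multiple (k := -1) _ E8);
  [rewrite oppr_eq0 oner_eq0|ring].
have R3 : r * (r + 1) = 0 by apply: (eq_of_multiple (k := 2) _ E6) => //; rewrite c0; ring.
have R4 : a * r = a * b - 2 * (b + r + 1) * q
  by apply: (eq_of_multiple (k := 1) _ E4); [rewrite oner_eq0|rewrite c0; ring].
have R5 : 2 * b * p - 2 * a * q = a ^+ 2 - 2 * (b + r + 1) * p
  by apply: (eq_of_multiple (k := 1) _ E5); [rewrite oner_eq0|rewrite c0; ring].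
move/eqP: R3; rewrite mulf_eq0 => /orP[/eqP r0 | /eqP r1].
  have a0 : a = 0 by rewrite -R2 r0 add0r mul1r.
  have b0 : b = 0 by rewrite -R1 r0 add0r mul1r.
  have q0 : q = 0 by apply: (eq_of_multiple (k := 2) _ R4) => //; rewrite a0 b0 r0; ring.
  have p0 : p = 0 by apply: (eq_of_multiple (k := 2) _ R5) => //; rewrite a0 b0 r0; ring.
  exists (Rep1 C), h, e, f; split=> //; split=> //.
    by rewrite phi_h a0 b0 c0 -lincomb_0.
  by rewrite phi_f p0 q0 r0 -lincomb_0.
have {}r1 : r = -1 by apply/eqP; rewrite -addr_eq0 r1.
have {}R4 : a * (b + 1) = 2 * b * q by apply: (eq_of_multiple (k := -1) _ R4);
  [rewrite oppr_eq0 oner_eq0|rewrite r1; ring].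
have {}R5 : 4 * b * p = a ^+ 2 + 2 * a * q
  by apply: (eq_of_multiple (k := 1) _ R5); [rewrite oner_eq0|rewrite r1; ring].
have [b0 | nz_b] := eqVneq b 0; last first.
  have qE : q = a * (b + 1) / (2 * b) by rewrite R4; field.
  have pE : p = a ^+ 2 * (2 * b + 1) / (4 * b ^+ 2).
    apply: (eq_of_multiple (k := 4 * b) _ R5); first by rewrite mulf_neq0 ?pnatr_eq0.
    by rewrite qE; field.
  (* With this shift the new first member is h + (a / b) e, an eigenvector. *)
  have t := triple_shift hef (- (a / (2 * b))).
  exists (Rep5 b); do 3!eexists; split; first exact: t.
  split=> //; rewrite phiE ?lincombZ ?lincombN; apply: lincombE; rewrite ?r1 ?c0 ?qE ?pE;
    by field.
have a0 : a = 0 by rewrite b0 add0r mulr1 mulr0 mul0r in R4.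
(* This shift removes the component of phi f along the first member. *)
have t := triple_shift hef (- q).
have [p_q | nz_p] := eqVneq p (q ^+ 2).
  exists (Rep5 0); do 3!eexists; split; first exact: t.
  split=> //; rewrite phiE ?lincombZ ?lincombN; apply: lincombE;
    rewrite ?r1 ?c0 ?p_q ?a0 ?b0; by ring.
pose d := sqrtC ((p - q ^+ 2) / - (2 * 'i)).
have d2 : d ^+ 2 = (p - q ^+ 2) / - (2 * 'i) by rewrite sqrtCK.
have nz_2i : - (2 * 'i) != 0 :> C by rewrite oppr_eq0 mulf_neq0 ?neq0Ci.
have nz_d : d != 0 by rewrite sqrtC_eq0 mulf_neq0 ?subr_eq0 ?invr_eq0.
exists (Rep4 C); do 3!eexists; split; first exact: (triple_scale t nz_d).
split=> //.
- by rewrite phiE (lincomb_0 h e f); apply: lincombE; rewrite ?r1 ?c0 ?a0 ?b0; ring.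
- by rewrite linearZ /= phi_e scaler0.
rewrite linearZ /= phiE [X in _ = _ *: (_ *: X) - _](lincomb_e h e f)
  !(lincombZ, lincombN, lincombD).
have pE : p = q ^+ 2 - 2 * 'i * d ^+ 2 by rewrite d2; field; rewrite neq0Ci.
by apply: lincombE; rewrite ?r1 ?a0 ?b0 ?c0 ?pE; field.
Qed.

(** This involution on Rota-Baxter operators exchanges the eigenvalues 0 and -1. *)
Definition complement phi : {linear L -> L} := @GRing.opp L \- phi.

Lemma complementE phi x : complement phi x = - x - phi x.
Proof. by []. Qed.

Lemma complement_rota_baxter phi : rota_baxter phi -> rota_baxter (complement phi).
Proof.
move=> rb x y; rewrite !complementE.
have -> : br (- x - phi x) y + br x (- y - phi y) + br x y
          = - (br (phi x) y + br x (phi y) + br x y).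
  rewrite brDl brDr !(brNl, brNr) -addrA (addrAC _ _ (br x y)) addNr add0r.
  by rewrite !opprD (addrC (- br x y)) addrAC.
rewrite [phi (- _)]linearN -rb !opprK -!opprD !(brNl, brNr, opprK) !(brDl, brDr).
by rewrite addrA; congr (_ + _); rewrite addrC (addrC (br x y)) addrA.
Qed.

(** The complement exchanges the first form with the second and, up to rescaling, the
    third with the fourth; it maps the fifth form with parameter k to the one with
    parameter - 1 - k, in the opposite triple. *)
Lemma complement_normal_form phi :
  (exists r, has_normal_form (complement phi) r) -> exists r, has_normal_form phi r.
Proof.
have phiE x : phi x = - x - complement phi x
  by rewrite complementE opprD opprK addrA addNr add0r opprK.
have two0 := two_neq0 C; have s2 : sqrtC 2 ^+ 2 = 2 :> C by rewrite sqrtCK.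
have nz_s : sqrtC 2 != 0 :> C by rewrite sqrtC_eq0.
move=> [[||||k] [h [e [f [t [hE eE fE]]]]]].
- exists (Rep2 C), h, e, f; split=> //.
  by split; rewrite phiE ?hE ?eE ?fE subr0.
- exists (Rep1 C), h, e, f; split=> //.
  by split; rewrite phiE ?hE ?eE ?fE opprK addNr.
- have nz_s' : (sqrtC 2)^-1 != 0 :> C by rewrite invr_eq0.
  exists (Rep4 C); do 3!eexists; split; first exact: (triple_scale t nz_s').
  split; rewrite ?linearZ /= phiE ?hE ?eE ?fE ?opprK ?addNr ?scaler0 //.
  rewrite invrK scalerDr scalerN addrC scalerN !scalerA -scaleNr; congr (_ *: _ - _).
  by field: s2.
- exists (Rep3 C); do 3!eexists; split; first exact: (triple_scale t nz_s).
  split; rewrite ?linearZ /= phiE ?hE ?eE ?fE ?subr0 ?scalerN //.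
  rewrite opprD opprK addrCA addNr addr0 -scaleNr opprK !scalerA; congr (_ *: _).
  by field: s2.
- exists (Rep5 (-1 - k)), (- h), f, e; split; first exact: triple_swap.
  split; rewrite ?linearN /= phiE ?hE ?eE ?fE ?subr0 ?opprK ?addNr //.
  by rewrite scalerBl scaleN1r.
Qed.

(** The eigenvalue of a nilpotent eigenvector is 0 or -1; passing to the complement
    in the second case, it is in the kernel. *)
Lemma rota_baxter_normal_form phi : rota_baxter phi -> exists r, has_normal_form phi r.
Proof.
move=> rb; have [h [e [f [l [t phi_e]]]]] := rota_baxter_nilpotent_eigenvector rb.
have l01 : l * (l + 1) = 0.
  have [b [a [c phi_h]]] := lincomb_surj t (phi h).
  have [q [p [r phi_f]]] := lincomb_surj t (phi f).
  have eE : phi e = lincomb h e f 0 l 0 by rewrite phi_e lincomb_def !scale0r add0r addr0.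
  have := rb (lincomb h e f 1 0 0) (lincomb h e f 0 1 0).
  rewrite !(linear_coords _ _ _ phi_h eE phi_f, br_lincomb t, lincombD).
  move=> /(lincomb_inj t)[_ E2 E3].
  have c0 : c = 0.
    by apply/eqP; rewrite -sqrf_eq0; apply/eqP; apply: (eq_of_multiple (k := 1) _ E3);
      rewrite ?oner_eq0 //; ring.
  by apply: (eq_of_multiple (k := -2) _ E2); rewrite ?oppr_eq0 ?two_neq0 // c0; ring.
move/eqP: l01; rewrite mulf_eq0 => /orP[/eqP l0 | /eqP l1].
  by apply: (normalize_kernel rb t); rewrite phi_e l0 scale0r.
apply: complement_normal_form; apply: (normalize_kernel _ t).
  exact: complement_rota_baxter.
by rewrite complementE phi_e -scaleN1r -scalerBl -opprD addrC l1 oppr0 scale0r.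
Qed.

(** * Distinct normal forms are not equivalent *)

Definition op_trace phi (X : 3.-tuple L) := \sum_i coord X i (phi X`_i).

Lemma op_trace_basis phi (X Y : 3.-tuple L) : basis_of fullv X -> basis_of fullv Y ->
  op_trace phi X = op_trace phi Y.
Proof.
move=> basX basY; rewrite /op_trace.
under eq_bigr => i _ do
  rewrite {1}(coord_basis basY (memvf X`_i)) !linear_sum /=.
rewrite exchange_big; apply: eq_bigr => j _ /=.
rewrite [in RHS](coord_basis basX (memvf (phi Y`_j))) linear_sum /=.
by apply: eq_bigr => i _; rewrite !linearZ /= mulrC.
Qed.

Lemma triple_trace phi h e f a1 b1 c1 a2 b2 c2 a3 b3 c3 : is_triple h e f ->
    phi h = lincomb h e f a1 b1 c1 -> phi e = lincomb h e f a2 b2 c2 ->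
    phi f = lincomb h e f a3 b3 c3 ->
  op_trace phi (sl2_basis C) = a1 + b2 + c3.
Proof.
move=> t hE eE fE; rewrite (op_trace_basis _ (sl2_basisP C) (triple_basis t)).
have fr := basis_free (triple_basis t).
have coE i a b c : coord (triple_tuple h e f) i (lincomb h e f a b c) = [:: a; b; c]`_i.
  rewrite lincomb_def -(coord_sum_free (fun i : 'I_3 => [:: a; b; c]`_i) i fr).
  by rewrite !big_ord_recl big_ord0 addr0 addrA.
by rewrite /op_trace !big_ord_recl big_ord0 /= hE eE fE !coE addr0 addrA.
Qed.

Definition form_trace (r : postlie_index C) : C :=
  match r with Rep1 => 0 | Rep2 => -3 | Rep3 => -2 | Rep4 => -1 | Rep5 k => k - 1 end.

(** All five normal forms have the same shape: diagonal on h and e, with phi f in the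
    span of e and f. *)
Definition form_coefs (r : postlie_index C) : C * C * C * C :=
  match r with
  | Rep1 => (0, 0, 0, 0)
  | Rep2 => (-1, -1, 0, -1)
  | Rep3 => (-1, -1, 'i, 0)
  | Rep4 => (0, 0, - (2 * 'i), -1)
  | Rep5 k => (k, 0, 0, -1)
  end.

Lemma normal_form_coords phi r h e f : normal_form phi r h e f ->
  let: (k, l, m, n) := form_coefs r in
  [/\ phi h = lincomb h e f k 0 0, phi e = lincomb h e f 0 l 0
   & phi f = lincomb h e f 0 m n].
Proof.
by case: r => [||||k] [-> -> ->] /=; split;
  rewrite lincomb_def ?(scale0r, scaleN1r, addr0, add0r).
Qed.

Lemma normal_form_trace phi r : has_normal_form phi r ->
  op_trace phi (sl2_basis C) = form_trace r.
Proof.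
case: r => [||||k] [h [e [f [t /normal_form_coords[hE eE fE]]]]];
  by rewrite (triple_trace t hE eE fE) /=; ring.
Qed.

(** For a and c nonzero, a e + c f is not nilpotent, hence is not an eigenvector of
    any ad u with nonzero eigenvalue. This tells the third and fourth forms from
    members of the fifth family with the same trace. *)
Lemma not_eigenvector_ad h e f u a c (s : C) : is_triple h e f ->
  a != 0 -> s != 0 -> br u (lincomb h e f 0 a c) = s *: lincomb h e f 0 a c -> c = 0.
Proof.
move=> t nz_a nz_s; have [x [y [z ->]]] := lincomb_surj t u.
rewrite (br_lincomb t) lincombZ => /(lincomb_inj t)[_ E1 E2].
apply/eqP; apply: contraTT isT => nz_c.
have x_s : 2 * x = s.
  by apply: (mulIf nz_a); rewrite -E1; ring.
have : - (2 * x) = s by apply: (mulIf nz_c); rewrite -E2; ring.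
move=> s_N; suff : s = 0 by move/eqP; rewrite (negPf nz_s).
by apply: (eq_of_multiple (k := -2) _ s_N); rewrite ?oppr_eq0 ?two_neq0 // x_s; ring.
Qed.

Lemma neq_sub_nat n (u v : C) : u - v = n.+1%:R -> u <> v.
Proof. by move=> uv u_v; move/eqP: uv; rewrite u_v subrr eq_sym pnatr_eq0. Qed.

(** Ranks the representatives, to treat each unordered pair of them once. *)
Definition rep_rank (r : postlie_index C) : nat :=
  match r with Rep1 => 1 | Rep2 => 2 | Rep3 => 3 | Rep4 => 4 | Rep5 _ => 5 end.

(** The traces 0, -3, -2, -1 and k - 1 separate all forms but, for i from 1 to 4, the
    i-th form and the member of the fifth family with the same trace. That member has
    k = 1, -2, -1 or 0. The first two are neither 0 nor - id. For k = -1, the kernel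
    is spanned by the nilpotent e, but in the third form by i e + f; for k = 0, the
    eigenspace of -1 is spanned by the nilpotent f, but in the fourth form by
    2 i e + f. *)
Lemma normal_form_unique phi r r' :
  has_normal_form phi r -> has_normal_form phi r' -> r = r'.
Proof.
wlog : r r' / (rep_rank r' <= rep_rank r)%N.
  by move=> main nf nf'; case: (leqP (rep_rank r') (rep_rank r)) => [|/ltnW] rr';
    [apply: main | apply/esym/main].
move=> rr' nf nf'.
have := etrans (esym (normal_form_trace nf)) (normal_form_trace nf').
case: r nf rr' => [||||k] nf; case: r' nf' => [||||k'] nf' //= _.
(* The first six pairs have different traces, all integers. *)
- by move/esym/(@neq_sub_nat 2); case; ring.
- by move/esym/(@neq_sub_nat 1); case; ring.
- by move/(@neq_sub_nat 0); case; ring.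
- by move/esym/(@neq_sub_nat 0); case; ring.
- by move/(@neq_sub_nat 1); case; ring.
- by move/(@neq_sub_nat 0); case; ring.
- move: nf nf' => [h [e [f [t [_ _ fE]]]]] [h' [e' [f' [t' nf']]]] _.
  suff phi0 : phi =1 \0.
    have [_ _ _] := triple_swap t.
    by rewrite -oppr_eq0 -fE phi0 eqxx.
  by apply: (linear_triple_ext t'); have [] := nf'.
- move: nf nf' => [h [e [f [t [_ eE _]]]]] [h' [e' [f' [t' nf']]]] _.
  suff phiN : phi =1 -%R.
    have [_ _ _] := t.
    by rewrite -oppr_eq0 -[- e]phiN eE eqxx.
  by apply: (linear_triple_ext t'); have [] := nf'.
- move: nf nf' => [h' [e' [f' [t' [_ eE' _]]]]] [h [e [f [t nf]]]] _.
  have [br_e _ _ /negP[]] := t'.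
  have [x [y [z e'E]]] := lincomb_surj t e'.
  have [hE eE fE] := normal_form_coords nf.
  move: eE'; rewrite e'E (linear_coords _ _ _ hE eE fE) => /(lincomb_eq0 t)[x0 yz _].
  have {}x0 : x = 0 by apply: (eq_of_multiple (k := -1) _ x0);
    [rewrite oppr_eq0 oner_eq0 | ring].
  have yE : y = 'i * z by apply: (eq_of_multiple (k := -1) _ yz);
    [rewrite oppr_eq0 oner_eq0 | ring].
  have z0 : z = 0.
    apply: contraTeq isT => nz_z.
    have nz_y : y != 0 by rewrite yE mulf_neq0 ?neq0Ci.
    rewrite e'E x0 in br_e.
    by have := not_eigenvector_ad t nz_y (two_neq0 C) br_e => /eqP; rewrite (negPf nz_z).
  by rewrite x0 yE z0 mulr0 -lincomb_0.
- move: nf nf' => [h' [e' [f' [t' [_ _ fE']]]]] [h [e [f [t nf]]]] _.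
  have [_ br_f _ _] := t'; have [_ _ _ /negP[]] := triple_swap t'.
  have [x [y [z f'E]]] := lincomb_surj t f'.
  have [hE eE fE] := normal_form_coords nf.
  move: fE'; rewrite f'E (linear_coords _ _ _ hE eE fE) lincombN.
  move=> /(lincomb_inj t)[x0 yz _].
  have {}x0 : x = 0 by apply: (eq_of_multiple (k := 1) _ x0); [rewrite oner_eq0 | ring].
  have yE : y = 2 * 'i * z by apply: (eq_of_multiple (k := 1) _ yz);
    [rewrite oner_eq0 | ring].
  have z0 : z = 0.
    apply: contraTeq isT => nz_z.
    have nz_y : y != 0 by rewrite yE !mulf_neq0 ?neq0Ci ?two_neq0.
    have n2 : (- 2 : C) != 0 by rewrite oppr_eq0 two_neq0.
    rewrite f'E x0 in br_f.
    by have := not_eigenvector_ad t nz_y n2 br_f => /eqP; rewrite (negPf nz_z).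
  by rewrite x0 yE z0 mulr0 -lincomb_0.
- by move=> /addIr ->.
Qed.

End NormalForms.

(** * PostLie structures and Rota-Baxter operators *)

Section Classification.
Variable C : numClosedFieldType.
Local Notation L := (sl2 C).
Local Notation br := (@sl2_br C).
Implicit Types (a b c d k l : C) (x y z h e f : L) (phi psi : {linear L -> L}).
Local Notation e1 := (e1 C).
Local Notation e2 := (e2 C).
Local Notation e3 := (e3 C).
Local Notation E := (lincomb e1 e2 e3).

Lemma linear_function_of (g : L -> L) : linear g ->
  exists phi, forall x, phi x = g x.
Proof.
move=> lin_g; pose gM := GRing.isLinear.Build _ _ _ _ g lin_g.
by pose G : {linear L -> L} := HB.pack g gM; exists G.
Qed.

Lemma linear_basis_ext phi psi (X : 3.-tuple L) : basis_of fullv X ->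
  (forall i : 'I_3, phi (tnth X i) = psi (tnth X i)) -> forall x, phi x = psi x.
Proof.
move=> basX eqX x; rewrite (coord_basis basX (memvf x)) !linear_sum.
by apply: eq_bigr => i _; rewrite !linearZ /= -tnth_nth eqX.
Qed.

Lemma bilinear_basis_ext (op op' : L -> L -> L) (X : 3.-tuple L) :
    basis_of fullv X -> bilinear_op op -> bilinear_op op' ->
    (forall i j : 'I_3, op (tnth X i) (tnth X j) = op' (tnth X i) (tnth X j)) ->
  forall x y, op x y = op' x y.
Proof.
move=> basX [opr opl] [opr' opl'] eqX x y.
have [l lE] := linear_function_of (opl y); have [l' lE'] := linear_function_of (opl' y).
rewrite -[LHS]lE -[RHS]lE'; apply: (linear_basis_ext basX) => i.
have [r rE] := linear_function_of (opr (tnth X i)).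
have [r' rE'] := linear_function_of (opr' (tnth X i)).
rewrite lE lE' -[LHS]rE -[RHS]rE'; apply: (linear_basis_ext basX) => j.
by rewrite rE rE'.
Qed.

Lemma br_op_bilinear phi : bilinear_op (fun x y => br (phi x) y).
Proof.
have [brr brl] := sl2_br_bilinear C.
by split=> z a x y /=; rewrite ?linearP; [apply: brr | apply: brl].
Qed.

Lemma centerless x : (forall y, br x y = 0) -> x = 0.
Proof.
have [h [e [f t]]] := exists_triple C.
have [a [b [c ->]]] := lincomb_surj t x => x0.
have := x0 (lincomb h e f 0 1 0); have := x0 (lincomb h e f 1 0 0).
rewrite !(br_lincomb t) => /(lincomb_eq0 t)[_ E1 _] /(lincomb_eq0 t)[E2 E3 _].
have two0 := two_neq0 C.
rewrite (lincomb_0 h e f); apply: lincombE.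
- by apply: (eq_of_multiple (k := 2) _ E3) => //; ring.
- by apply: (eq_of_multiple (k := -2) _ E1); rewrite ?oppr_eq0 //; ring.
- by apply: (eq_of_multiple (k := -1) _ E2); rewrite ?oppr_eq0 ?oner_eq0 //; ring.
Qed.

(** By the Jacobi identity the third PostLie axiom says that the defect w y z of the
    Rota-Baxter relation brackets to zero with every x; the last axiom says that
    every [phi z, -] is a derivation. *)
Lemma postlie_rota_baxter circ phi : (forall x y, circ x y = br (phi x) y) ->
  is_postlie br circ <-> rota_baxter phi.
Proof.
move=> circE.
pose w y z := br (phi y) (phi z) - phi (br (phi y) z + br y (phi z) + br y z).
have assocE x y z : circ z (circ y x) - circ y (circ z x)
      + circ (circ y z) x - circ (circ z y) x + circ (br y z) x = - br (w y z) x.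
  rewrite !circE /w brDl brNl opprB [br y (phi z)]br_antisym !linearD !brDl linearN brNl.
  have := br_jacobi (phi y) (phi z) x.
  rewrite [br (br x _) _]br_antisym [br x (phi y)]br_antisym brNr opprK.
  rewrite [br (br (phi z) x) _]br_antisym.
  rewrite -addrA => /eqP; rewrite addr_eq0 => /eqP ->.
  by rewrite opprK [RHS]addrC !addrA.
split=> [[_ _ _ _ assoc _] y z | rb].
  apply/eqP; rewrite -subr_eq0; apply/eqP/centerless => x.
  by apply: oppr_inj; rewrite -assocE assoc oppr0.
split.
- exact: sl2_br_bilinear.
- have [circl circr] := br_op_bilinear phi.
  by split=> z a x y; rewrite !circE; [apply: circl | apply: circr].
- exact: br_antisym.
- exact: br_jacobi.
- by move=> x y z; rewrite assocE /w rb subrr br_antisym br0 !oppr0.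
- move=> x y z; rewrite !circE.
  have := br_jacobi x y (phi z).
  rewrite [br (br x y) _]br_antisym [br (br y _) _]br_antisym [br y (phi z)]br_antisym brNr
    opprK.
  by move=> /eqP; rewrite -oppr_eq0 !opprD opprK => /eqP.
Qed.

(** The last PostLie axiom makes every left multiplication a derivation. *)
Lemma postlie_op_is_br circ : is_postlie br circ ->
  exists phi, forall x y, circ x y = br (phi x) y.
Proof.
move=> [_ [circr circl] _ _ _ der].
have inner z : exists u, forall y, circ z y = br u y.
  have [h [e [f t]]] := exists_triple C.
  have [D DE] := linear_function_of (circr z).
  have [x y|u uE] := @derivation_inner C h e f t D.
    by rewrite !DE; apply/eqP; rewrite -subr_eq0 opprD addrA der.
  by exists u => y; rewrite -DE.
have [h [e [f t]]] := exists_triple C.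
have [u uE] := inner h; have [v vE] := inner e; have [w wE] := inner f.
have [phi [hE eE fE]] := linear_on_triple t u v w.
exists phi => x y.
have [l lE] := linear_function_of (circl y).
have [_ phil] := br_op_bilinear phi.
have [m mE] := linear_function_of (phil y).
rewrite -[LHS]lE -[RHS]mE; apply: (linear_triple_ext t);
  by rewrite lE mE ?hE ?eE ?fE ?uE ?vE ?wE.
Qed.

Lemma automorphism_triple g h e f : lie_automorphism br g ->
  is_triple h e f -> is_triple (g h) (g e) (g f).
Proof.
move=> [lin_g bij_g mor_g] [he hf ef nz_e].
have [G GE] := linear_function_of lin_g.
split; rewrite -?mor_g ?he ?hf ?ef -?GE ?linearZ //.
apply: contraNneq nz_e => e0; apply/eqP/(bij_inj bij_g).
by rewrite -GE e0 -GE linear0.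
Qed.

(** An isomorphism g satisfies [psi (g x) - g (phi x), -] = 0, so it conjugates phi
    into psi and carries a triple adapted to phi to one adapted to psi. *)
Lemma isomorphic_normal_form phi psi circ star r :
    (forall x y, circ x y = br (phi x) y) -> (forall x y, star x y = br (psi x) y) ->
    postlie_isomorphic br circ star ->
  has_normal_form phi r -> has_normal_form psi r.
Proof.
move=> circE starE [g [aut_g gE]] [h [e [f [t nf]]]].
have [lin_g bij_g mor_g] := aut_g.
have [G GE] := linear_function_of lin_g.
have conj x : psi (g x) = g (phi x).
  apply/eqP; rewrite eq_sym -subr_eq0; apply/eqP/centerless => y.
  have [g' _ gK] := bij_g.
  by rewrite -(gK y) brDl brNl -mor_g -circE -starE gE subrr.
exists (g h), (g e), (g f); split; first exact: automorphism_triple.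
by case: r nf => [||||k] /= [hE eE fE]; split;
  rewrite conj ?hE ?eE ?fE -!GE ?linear0 ?linearB ?linearN ?linearZ.
Qed.

(** The linear map between two triples is an automorphism, because the bracket has
    the same structure constants on all triples. *)
Lemma normal_form_isomorphic phi psi circ star r :
    (forall x y, circ x y = br (phi x) y) -> (forall x y, star x y = br (psi x) y) ->
    has_normal_form phi r -> has_normal_form psi r ->
  postlie_isomorphic br circ star.
Proof.
move=> circE starE [h [e [f [t nf]]]] [h' [e' [f' [t' nf']]]].
have [g [gh ge gf]] := linear_on_triple t h' e' f'.
have [g' [gh' ge' gf']] := linear_on_triple t' h e f.
have gE a b c : g (lincomb h e f a b c) = lincomb h' e' f' a b c.
  by rewrite linear_lincomb gh ge gf lincomb_def.
have gE' a b c : g' (lincomb h' e' f' a b c) = lincomb h e f a b c.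
  by rewrite linear_lincomb gh' ge' gf' lincomb_def.
have br_g x y : g (br x y) = br (g x) (g y).
  have [a [b [c ->]]] := lincomb_surj t x; have [a' [b' [c' ->]]] := lincomb_surj t y.
  by rewrite (br_lincomb t) !gE (br_lincomb t').
exists g; split; first split=> //.
- by move=> a x y; rewrite linearP.
- exists g' => x; first by have [a [b [c ->]]] := lincomb_surj t x; rewrite gE gE'.
  by have [a [b [c ->]]] := lincomb_surj t' x; rewrite gE' gE.
move=> x y; rewrite circE starE br_g; congr (br _ _).
apply: (@linear_triple_ext C h e f t _ (g \o phi) (psi \o g));
  case: r nf nf' => [||||k] /= [hE eE fE] [hE' eE' fE'];
  rewrite /= ?gh ?ge ?gf ?hE ?eE ?fE ?hE' ?eE' ?fE';
  by rewrite ?linear0 ?linearB ?linearN ?linearZ /= ?gh ?ge ?gf.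
Qed.

Lemma normal_form_rota_baxter phi r : has_normal_form phi r -> rota_baxter phi.
Proof.
move=> [h [e [f [t nf]]]] x y.
have [a [b [c ->]]] := lincomb_surj t x; have [a' [b' [c' ->]]] := lincomb_surj t y.
case: r nf => [||||k] /normal_form_coords[hE eE fE];
  by rewrite !(linear_coords _ _ _ hE eE fE, br_lincomb t, lincombD); apply: lincombE; ring.
Qed.

(** * The listed representatives *)

Lemma rep_op_br (r : postlie_index C) phi u1 u2 u3 :
    phi e1 = u1 -> phi e2 = u2 -> phi e3 = u3 ->
    (forall j : 'I_3, let y := tnth (sl2_basis C) j in
      [/\ rep_table r ord0 j = br u1 y, rep_table r (lift ord0 ord0) j = br u2 y
         & rep_table r (lift ord0 (lift ord0 ord0)) j = br u3 y]) ->
  forall x y, rep_op r x y = br (phi x) y.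
Proof.
move=> <- <- <- tab.
apply: (bilinear_basis_ext (sl2_basisP C) (rep_op_bilinear r) (br_op_bilinear phi)).
move=> i j; rewrite rep_opE; have [t1 t2 t3] := tab j.
by case: i => [[|[|[|i]]] ltm].
Qed.

Lemma linear_on_sl2_basis u1 u2 u3 :
  exists phi, [/\ phi e1 = u1, phi e2 = u2 & phi e3 = u3].
Proof.
have [phi phiE] := linear_of_free (sl2_basis C) [:: u1; u2; u3].
by exists phi; have [] := phiE (basis_free (sl2_basisP C)) erefl.
Qed.

Let i2 : 'i ^+ 2 = -1 :> C := sqrCi C.

Lemma rep_op_normal_form r : exists phi,
  (forall x y, rep_op r x y = br (phi x) y) /\ has_normal_form phi r.
Proof.
have two0 := two_neq0 C.
case: r => [||||k].
- have [phi [E1 E2 E3]] := linear_on_sl2_basis 0 0 0.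
  exists phi; split.
    apply: (rep_op_br E1 E2 E3) => j /=; split;
    by rewrite br_antisym br0 oppr0.
  do 3!eexists; split; first exact: rep5_triple.
  rewrite (lincomb_0 e1 e2 e3) in E1 E2 E3.
  by split; rewrite (linear_coords _ _ _ E1 E2 E3) (lincomb_0 e1 e2 e3); apply: lincombE;
    ring.
- have [phi [E1 E2 E3]] := linear_on_sl2_basis (- e1) (- e2) (- e3).
  exists phi; split; first exact: (rep_op_br E1 E2 E3).
  have phiN : forall x, phi x = - x.
    have lin_N : linear (@GRing.opp L) by move=> a x y; rewrite opprD scalerN.
    have [N NE] := linear_function_of lin_N.
    move=> x; rewrite -NE; move: x; apply: (linear_basis_ext (sl2_basisP C)) => i.
    by rewrite NE; case: i => [[|[|[|]]] // ltm].
  by do 3!eexists; split; first exact: rep5_triple.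
- pose v : L := - ((1 + 'i) / 2) *: e2 + (('i - 1) / 2) *: e3.
  have vE : v = E 0 (- ((1 + 'i) / 2)) (('i - 1) / 2) by rewrite lincomb_def scale0r add0r.
  have [phi [E1 E2 E3]] := linear_on_sl2_basis (- e1) v v.
  exists phi; split; first exact: (rep_op_br E1 E2 E3).
  do 3!eexists; split; first exact: rep3_triple.
  rewrite vE in E2 E3; rewrite {2}(lincomb_h e1 e2 e3) lincombN in E1.
  by split; rewrite (linear_coords _ _ _ E1 E2 E3) ?lincombN ?lincombZ; apply: lincombE;
    field: i2.
- have [phi [E1 E2 E3]] := linear_on_sl2_basis (('i - 1 / 2) *: e1 + (1 - 'i / 2) *: e2)
    ((1 + 'i / 2) *: e1 - ('i + 1 / 2) *: e2) 0.
  exists phi; split.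
    by apply: (rep_op_br E1 E2 E3) => j /=; split; rewrite // [br 0 _]br_antisym br0 oppr0.
  do 3!eexists; split; first exact: rep4_triple.
  have {}E1 : phi e1 = E ('i - 1 / 2) (1 - 'i / 2) 0
    by rewrite E1 lincomb_def scale0r addr0.
  have {}E2 : phi e2 = E (1 + 'i / 2) (- ('i + 1 / 2)) 0
    by rewrite E2 lincomb_def scale0r addr0 scaleNr.
  rewrite (lincomb_0 e1 e2 e3) in E3.
  by split; rewrite (linear_coords _ _ _ E1 E2 E3) ?lincombN ?lincombZ ?lincombD
    ?[0 in RHS](lincomb_0 e1 e2 e3); apply: lincombE; field: i2.
- have [phi [E1 E2 E3]] := linear_on_sl2_basis (k *: e1) (- (1 / 2) *: e2 + ('i / 2) *: e3)
    (- ('i / 2) *: e2 - (1 / 2) *: e3).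
  exists phi; split; first exact: (rep_op_br E1 E2 E3).
  do 3!eexists; split; first exact: rep5_triple.
  have {}E1 : phi e1 = E k 0 0 by rewrite E1 lincomb_def !scale0r !addr0.
  have {}E2 : phi e2 = E 0 (- (1 / 2)) ('i / 2) by rewrite E2 lincomb_def scale0r add0r.
  have {}E3 : phi e3 = E 0 (- ('i / 2)) (- (1 / 2))
    by rewrite E3 lincomb_def scale0r add0r !scaleNr.
  by split; rewrite (linear_coords _ _ _ E1 E2 E3) ?lincombN ?lincombZ
    ?[0 in RHS](lincomb_0 e1 e2 e3); apply: lincombE; field: i2.
Qed.

End Classification.

Local Open Scope complex_scope.

Theorem theorem1p2 (R : realType) :
  (forall r : postlie_index R[i], is_postlie (@sl2_br R[i]) (rep_op r))
  /\ (forall circ : sl2 R[i] -> sl2 R[i] -> sl2 R[i],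
        is_postlie (@sl2_br R[i]) circ ->
        exists! r : postlie_index R[i],
          postlie_isomorphic (@sl2_br R[i]) circ (rep_op r)).
Proof.
split=> [r | circ circ_postlie].
  have [phi [repE nf]] := rep_op_normal_form r.
  exact/(postlie_rota_baxter repE)/(normal_form_rota_baxter nf).
have [phi circE] := postlie_op_is_br circ_postlie.
have [r nf] := rota_baxter_normal_form (proj1 (postlie_rota_baxter circE) circ_postlie).
exists r; split=> [|r' iso].
  have [psi [repE nf']] := rep_op_normal_form r.
  exact: normal_form_isomorphic circE repE nf nf'.
have [psi [repE nf']] := rep_op_normal_form r'.
exact: normal_form_unique (isomorphic_normal_form circE repE iso nf) nf'.
Qed.
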